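(* Let $P$ be a dynamic path with vertices $x_0<x_1<\dots<x_n$, weights $w_0,\dots,w_n$, edge capacities $c_1,\dots,c_n$ and unit-distance travel time $\tau$, as described in the context. Let $x$ be a point with $x_k<x\le x_{k+1}$ for some $0\le k<n$. Then $$\Theta_L(P,x)=\max_{i:\,x_i<x}\left((x-x_i)\tau+\left\lceil\frac{\sum_{0\le j\le i}w_j}{\min_{i+1\le j\le k+1}c_j}\right\rceil-1\right),$$ $$\Theta_R(P,x)=\max_{i:\,x_i>x}\left((x_i-x)\tau+\left\lceil\frac{\sum_{i\le j\le n}w_j}{\min\{c_j:\ j\le i,\ x_j>x\}}\right\rceil-1\right),$$ where a maximum over an empty index set is interpreted as $0$. (Here $\{c_j: j\le i,\ x_j>x\}$ is the set of capacities of the edges $e_j=(x_{j-1},x_j)$ that meet the open interval $(x,x_i)$.)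
   Context: A dynamic path $P$ consists of real points (vertices) $x_0<x_1<\dots<x_n$, edges $e_i=(x_{i-1},x_i)$ for $1\le i\le n$, a constant $\tau>0$ (the time needed to travel one unit of distance) such that every $|x_i-x_j|\tau$ is an integer, nonnegative integer weights $w_i$ (the number of people initially at $x_i$), and positive integer capacities $c_i$ (of edge $e_i$). Discrete evacuation model: a sink $x\in[x_0,x_n]$ is fixed and every person moves along the path toward $x$. Time is discrete. At each vertex, people wanting to enter the next edge toward the sink wait in a first-in-first-out queue; at each integer time step at most $c_i$ people (one ''wave'') may enter edge $e_i$, and people enter as soon as capacity and the queue permit. A wave covers distance $d$ in time $d\tau$; on reaching the far vertex of an edge its members join that vertex's queue (or, if the sink lies on the edge, they reach the sink). People starting at $x$ (if $x$ is a vertex) are evacuated at time $0$. $\Theta_L(P,x)$ (resp. $\Theta_R(P,x)$) denotes the time at which all people starting on vertices strictly to the left (resp. right) of $x$ have reached $x$; equivalently the time at which the last person from $x_0$ (resp. $x_n$) reaches $x$.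
   Formalization: The formulas fail when w_0=0 (resp. w_n=0), as unpopulated far vertices add spurious terms; the formal theorem omits terms whose accumulated weight is 0 for general weights, and proves the formulas as written when w_0>0 (resp. w_n>0). *)

(* Defs.v *)
From HB Require Import structures.
From mathcomp Require Import all_boot all_order all_algebra.
From mathcomp Require Import boolp classical_sets reals.

Set Implicit Arguments.
Unset Strict Implicit.
Unset Printing Implicit Defensive.

Import Order.TTheory GRing.Theory Num.Theory.
Local Open Scope ring_scope.

(* The edge (x_(i-1), x_i) is numbered by its right endpoint, so [cap i] is   *)
(* meaningful for 1 <= i <= n only; [cap ord0] is a dummy value that nothing  *)
(* below depends on (up to the default value in [min_cap]).                   *)
Record dynpath (R : realType) (n : nat) := DynPath {
  pos : 'I_n.+1 -> R;
  wt : 'I_n.+1 -> nat;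
  cap : 'I_n.+1 -> nat;
  tau : R;
  pos_lt : forall i j : 'I_n.+1, (i < j)%N -> pos i < pos j;
  cap_gt0 : forall i : 'I_n.+1, (0 < i)%N -> (0 < cap i)%N;
  tau_gt0 : 0 < tau;
  dist_int : forall i j : 'I_n.+1, `|pos i - pos j| * tau \is a Num.int
}.

Section Evacuation.
Context {R : realType} {n : nat} (P : dynpath R n).

(* A person is a starting vertex [tag p] together with a rank there. *)
Definition person : Type := {v : 'I_n.+1 & 'I_(wt P v)}.

Definition people (v : 'I_n.+1) : seq person :=
  [seq Tagged (fun u => 'I_(wt P u)) j | j <- enum 'I_(wt P v)].

Variable x : R.

(* Capacity of the edge leaving v towards the sink x; nobody leaves x. *)
Definition out_cap (v : 'I_n.+1) : nat :=
  if pos P v < x then cap P (inord v.+1)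
  else if x < pos P v then cap P v
  else 0%N.

(* The edge from u towards x ends at v, and the sink is not met before v. *)
Definition feeds (u v : 'I_n.+1) : bool :=
  ((u.+1 == v)%N && (pos P v <= x)) || ((v.+1 == u)%N && (x <= pos P v)).

(* Queues are listed front first.  [Q t v] is the queue at v at time t, after *)
(* the arrivals and before the departures of time t, so that the wave leaving *)
(* v at time t is its longest prefix allowed by the capacity.                 *)
Definition wave (Q : nat -> 'I_n.+1 -> seq person) (t : nat) (v : 'I_n.+1) :
    seq person :=
  take (out_cap v) (Q t v).

Definition arrivals (Q : nat -> 'I_n.+1 -> seq person) (t : nat)
    (v : 'I_n.+1) : seq person :=
  \big[cat/[::]]_(u : 'I_n.+1 | feeds u v)
    \big[cat/[::]]_(s < t | s%:R + `|pos P u - pos P v| * tau P == t%:R)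
      wave Q s u.

(* Course-of-values recursion: [history t] is the evolution of the queues up  *)
(* to time t.  The equations that determine [queue] are [queue0] and [queueS].*)
Fixpoint history (t : nat) : nat -> 'I_n.+1 -> seq person :=
  if t is t'.+1 then
    fun s v => if (s <= t')%N then history t' s v
               else drop (out_cap v) (history t' t' v)
                    ++ arrivals (history t') t'.+1 v
  else fun _ => people.

Definition queue (t : nat) : 'I_n.+1 -> seq person := history t t.

Lemma historyE s t : (s <= t)%N -> history t s = queue s.
Proof.
elim: t => [|t IHt]; first by rewrite leqn0 => /eqP ->.
rewrite leq_eqVlt ltnS => /predU1P[-> //|les].
by rewrite -IHt //; apply/funext => v /=; rewrite les.
Qed.

Lemma queue0 v : queue 0 v = people v.
Proof. by []. Qed.

Lemma queueS t v :
  queue t.+1 v = drop (out_cap v) (queue t v) ++ arrivals queue t.+1 v.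
Proof.
rewrite {1}/queue /= ltnn; congr (_ ++ _).
apply: eq_bigr => u _; apply: eq_bigr => s _.
by rewrite /wave historyE // -ltnS.
Qed.

(* x lies on the edge leaving v towards x, possibly at its far end; the       *)
(* out-of-range cases [inord n.+1] and [inord 0.-1] make the disjunct false.  *)
Definition last_stop (v : 'I_n.+1) : bool :=
  (pos P v < x <= pos P (inord v.+1)) || (pos P (inord v.-1) <= x < pos P v).

Definition reached_by (T : R) (p : person) : Prop :=
  (pos P (tag p) = x /\ 0 <= T) \/
  exists v : 'I_n.+1, exists s : nat,
    [/\ last_stop v, p \in wave queue s v
      & s%:R + `|x - pos P v| * tau P <= T].

Definition Theta_L : R :=
  inf [set T : R | 0 <= T /\
         forall p : person, pos P (tag p) < x -> reached_by T p]%classic.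

Definition Theta_R : R :=
  inf [set T : R | 0 <= T /\
         forall p : person, x < pos P (tag p) -> reached_by T p]%classic.

(* The default value is neutral for minn on the values of [cap]: this is the  *)
(* true minimum over D as soon as D is nonempty.                              *)
Definition min_cap (D : pred 'I_n.+1) : nat :=
  (\big[minn / \max_(l < n.+1) cap P l]_(j < n.+1 | D j) cap P j)%N.

Definition left_weight (i : 'I_n.+1) : nat :=
  (\sum_(j < n.+1 | (j <= i)%N) wt P j)%N.

Definition right_weight (i : 'I_n.+1) : nat :=
  (\sum_(j < n.+1 | (i <= j)%N) wt P j)%N.

Definition left_term (k : nat) (i : 'I_n.+1) : R :=
  (x - pos P i) * tau P
  + (Num.ceil ((left_weight i)%:R
               / (min_cap (fun j => (i.+1 <= j <= k.+1)%N))%:R : R))%:~R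
  - 1.

Definition right_term (i : 'I_n.+1) : R :=
  (pos P i - x) * tau P
  + (Num.ceil ((right_weight i)%:R
               / (min_cap (fun j => (j <= i)%N && (x < pos P j)))%:R : R))%:~R
  - 1.

End Evacuation.

(* Main.v *)
(* On each side of the sink the path is a line of first-in-first-out queues.  *)
(* Let D_v(t) be the number of people who leave station v before time t, w_v  *)
(* the number of people starting at v, W_v = w_0 + ... + w_v, and c_v the     *)
(* capacity out of v.  Then                                                   *)
(*   D_v(t+1) = min(D_v(t) + c_v, w_v + D_(v-1)(t + 1 - delay))               *)
(* and, by induction, D_v(t) is the least of W_v and of all                   *)
(*   W_v - W_u + (t - delay(u, v)) c_j   for u <= j <= v.                     *)
(* Hence all W_v people have left iff W_u <= (t - delay(u, v)) c_j for all    *)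
(* u <= j <= v, which is the formula once solved for t.  Since departures     *)
(* form a prefix of the list of upstream people, counting them is enough.     *)

Require Import Defs.
From HB Require Import structures.
From mathcomp Require Import all_boot all_order all_algebra.
From mathcomp Require Import boolp classical_sets reals.
From mathcomp Require Import zify ring.

Set Implicit Arguments.
Unset Strict Implicit.
Unset Printing Implicit Defensive.

Import Order.TTheory GRing.Theory Num.Theory.
Local Open Scope nat_scope.

(** On one side of the sink nobody overtakes, so cumulative departure counts from the last stop
    decide everything. Conservation of people and maximal waves make each count the minimum of a
    capacity bound and a supply bound ([departed0_rec], [departedS_rec]). Unrolling this recursion
    gives bottleneck bounds, one for each origin [u] and each later station [j] ([departed_ub]), and
    shows that they are the only obstructions ([departed_lb]). Hence [all_departed] turns complete
    evacuation into a family of inequalities. For each [u] the smallest capacity gives the binding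
    one, and [ceil_le_truncn] solves it for the time, which produces the ceiling and the [- 1].
    [evacuation_time] carries this out for one abstract side; [Theta_LE] and [Theta_RE] apply it to
    the actual sides. *)

(** * Departure counts on a line of queues *)

Section Line.
(* Station m feeds station m.+1; [a m] is the travel time from station 0.     *)
Context {T : eqType} (M : nat) (ppl : nat -> seq T) (c a : nat -> nat).
Context (q : nat -> nat -> seq T).
Hypothesis a_lt : forall m, m < M -> a m < a m.+1.
Hypothesis q0 : forall m, m <= M -> q 0 m = ppl m.
Hypothesis qS0 : forall t, q t.+1 0 = drop (c 0) (q t 0).
Hypothesis qSS : forall t m, m < M ->
  q t.+1 m.+1 = drop (c m.+1) (q t m.+1) ++
    (if a m.+1 - a m <= t.+1 then take (c m) (q (t.+1 - (a m.+1 - a m)) m)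
     else [::]).

(** Only departures at times strictly before [t] count. Lists are kept rather than numbers so that
    their order can be compared with [upstream]. *)
Fixpoint departed (m t : nat) : seq T :=
  if t is t'.+1 then departed m t' ++ take (c m) (q t' m) else [::].

Fixpoint upstream (m : nat) : seq T :=
  if m is m'.+1 then ppl m ++ upstream m' else ppl 0.

Let D m t := size (departed m t).
Let W m := size (upstream m).

Lemma departed_queue0 t : departed 0 t ++ q t 0 = ppl 0.
Proof. by elim: t => [|t IHt] /=; rewrite ?q0 // qS0 -catA cat_take_drop. Qed.

(** Conservation of people. The queue at time [t] already holds the arrivals of time [t], that is,
    the waves that left [m] up to [t] minus the delay; hence [t.+1]. *)
Lemma departed_queueS m t : m < M ->
  departed m.+1 t ++ q t m.+1 =
  ppl m.+1 ++ departed m (t.+1 - (a m.+1 - a m)).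
Proof.
move=> ltmM; have ltam := a_lt ltmM; elim: t => [|t IHt] /=.
  have -> : 1 - (a m.+1 - a m) = 0 by lia.
  by rewrite q0 // cats0.
rewrite qSS // catA -(catA (departed _ _)) cat_take_drop IHt -catA;
  congr (_ ++ _).
case: leqP => lead; last by rewrite cats0; congr departed; lia.
by rewrite (subSn lead).
Qed.

(* Queues being first-in-first-out, the order of departure is upstream order. *)
Lemma departed_prefix m t : m <= M -> prefix (departed m t) (upstream m).
Proof.
elim: m t => [|m IHm] t lemM.
  by rewrite /= -(departed_queue0 t) prefix_prefix.
apply: (@catl_prefix _ _ _ (q t m.+1)).
by rewrite departed_queueS //= prefix_catr // eqxx IHm // ltnW.
Qed.

Lemma departedS m t : m <= M -> D m t <= D m t.+1 <= D m t + c m.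
Proof. by rewrite /D /= size_cat size_take_min; lia. Qed.

Lemma departed0_rec t : D 0 t.+1 = minn (D 0 t + c 0) (W 0).
Proof.
have := congr1 size (departed_queue0 t).
by rewrite /D /W /= !size_cat size_take_min; lia.
Qed.

(** A wave is limited by the capacity or by the queue; in the second case everybody who was ever at
    the station has left, and conservation counts them. *)
Lemma departedS_rec m t : m < M ->
  D m.+1 t.+1 =
  minn (D m.+1 t + c m.+1) (size (ppl m.+1) + D m (t.+1 - (a m.+1 - a m))).
Proof.
move=> /(departed_queueS t)/(congr1 size).
by rewrite /D /W /= !size_cat size_take_min; lia.
Qed.

Lemma upstreamS m : W m.+1 = size (ppl m.+1) + W m.
Proof. by rewrite /W /= size_cat. Qed.

Lemma a_le m m' : m <= m' <= M -> a m <= a m'.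
Proof.
move=> /andP[]; elim: m' => [|m' IHm']; first by rewrite leqn0 => /eqP->.
by rewrite leq_eqVlt => /predU1P[->//|lem] ltM; have := a_lt ltM;
  have := IHm' lem; lia.
Qed.

Lemma departed_linear m t r : m <= M -> D m (t + r) <= D m t + r * c m.
Proof.
move=> lemM; elim: r => [|r IHr]; first by rewrite addn0 leq_addr.
by have := departedS (t + r) lemM; rewrite addnS; lia.
Qed.

Lemma departed_homo m t t' : m <= M -> t <= t' -> D m t <= D m t'.
Proof.
move=> lemM /subnK <-; elim: (t' - t) => // r IHr.
by have := departedS (r + t) lemM; rewrite addSn; lia.
Qed.

(** Beyond [W v - W u], departures from [v] involve people from [u] or farther. These leave [j] no
    earlier than [a j - a u], and before [t - (a v - a j)] if they leave [v] before [t]. *)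
Lemma departed_ub v u j t : v <= M -> u <= j <= v ->
  D v t + W u <= W v + (t - (a v - a u)) * c j.
Proof.
elim: v u j t => [|v IHv] u j t levM /andP[leuj lejv].
  have -> : u = 0 by lia. have -> : j = 0 by lia.
  have := departed_linear 0 t levM; rewrite add0n subnn subn0 {2}/D /=; lia.
case: (eqVneq u v.+1) => [equ|neu].
  have -> : j = v.+1 by lia. rewrite equ.
  have := departed_linear 0 t levM; rewrite add0n subnn subn0 {2}/D /=; lia.
have leuv : u <= v by lia.
have av := a_lt levM; have au : a u <= a v by apply: a_le; lia.
have leD t' : D v.+1 t' <= size (ppl v.+1) + D v (t' - (a v.+1 - a v)).
  case: t' => [|t']; first by rewrite /D.
  by rewrite departedS_rec // geq_minr.
rewrite upstreamS; case: (eqVneq j v.+1) => [->|nej].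
  (* Nobody from u can have left v.+1 before a v.+1 - a u, and then the flow *)
  (* is limited by the last capacity.                                        *)
  set d := a v.+1 - a u.
  have D0 : D v.+1 d + W u <= size (ppl v.+1) + W v.
    have := leD d; have := IHv u v (d - (a v.+1 - a v)) (ltnW levM).
    rewrite leuv leqnn => /(_ isT).
    have -> : d - (a v.+1 - a v) - (a v - a u) = 0 by lia.
    lia.
  case: (leqP t d) => ltd.
    by have := departed_homo levM ltd; lia.
  have := departed_linear d (t - d) levM; rewrite subnKC; lia.
have := leD t; have := IHv u j (t - (a v.+1 - a v)) (ltnW levM) ltac:(lia).
have -> : t - (a v.+1 - a v) - (a v - a u) = t - (a v.+1 - a u) by lia.
lia.
Qed.

(** Follows both branches of the minimum: the capacity branch goes back one time step and lowers [b]
    by a capacity, the supply branch goes to the previous station. Hence [b] must vary in the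
    induction. *)
Lemma departed_lb v t b : v <= M -> b <= W v ->
  (forall u j, u <= j <= v -> b + W u <= W v + (t - (a v - a u)) * c j) ->
  b <= D v t.
Proof.
elim: v t b => [|v IHv] t b levM; elim: t b => [|t IHt] b leb bP.
- have := bP 0 0 isT; rewrite sub0n mul0n; lia.
- rewrite departed0_rec leq_min leb andbT.
  suff: b - c 0 <= D 0 t by lia.
  case: (leqP b (c 0)) => lebc; first by rewrite (eqP (_ : b - c 0 == 0)).
  apply: IHt; first lia.
  move=> u j leuj; have := bP u j leuj; have -> : j = 0 by lia.
  have -> : u = 0 by lia.
  rewrite subnn !subn0 mulSn; lia.
- have := bP v.+1 v.+1; rewrite sub0n mul0n leqnn; lia.
rewrite departedS_rec // leq_min; have av := a_lt levM; apply/andP; split.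
  suff: b - c v.+1 <= D v.+1 t by lia.
  case: (leqP b (c v.+1)) => lebc; first by rewrite (eqP (_ : b - c v.+1 == 0)).
  apply: IHt; first lia.
  move=> u j leuj; have bP1 := bP u j leuj.
  (* The bound for [j] suffices if [c j <= c v.+1], the bound for [v.+1] otherwise. *)
  have := bP u v.+1 ltac:(lia); move: bP1.
  set y := a v.+1 - a u.
  have [->|[-> ->]] : t.+1 - y = (t - y).+1 \/
    (t.+1 - y = 0 /\ t - y = 0) by lia.
    nia.
  lia.
case: (leqP b (size (ppl v.+1))) => lebp; first lia.
suff: b - size (ppl v.+1) <= D v (t.+1 - (a v.+1 - a v)) by lia.
apply: IHv; [exact: ltnW|by move: leb; rewrite upstreamS; lia|].
move=> u j leuj; have := bP u j ltac:(lia); rewrite upstreamS.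
have au : a u <= a v by apply: a_le; lia.
have -> : t.+1 - (a v.+1 - a v) - (a v - a u) = t.+1 - (a v.+1 - a u) by lia.
lia.
Qed.

(** Departures form a prefix of [upstream M], so having full length means being the whole list; the
    counting bounds are used with [b = W M]. *)
Lemma all_departed t : uniq (upstream M) ->
  {subset upstream M <= departed M t} <->
  (forall u j, u <= j <= M -> W u <= (t - (a M - a u)) * c j).
Proof.
move=> uniqM; split=> [sub u j leuj|ubW].
  have := departed_ub t (leqnn M) leuj; have := uniq_leq_size uniqM sub.
  rewrite -/(W M) -/(D M t); lia.
have /departed_lb : W M <= W M by [].
move=> /(_ t (leqnn M)) leD p; have /prefixP[s] := departed_prefix t (leqnn M).
have : W M <= D M t by apply: leD => u j leuj; rewrite leq_add2l ubW.
move=> + eqM; rewrite /W /D {1}eqM size_cat -[X in _ <= X]addn0 leq_add2l leqn0.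
by move=> /nilP s0; rewrite eqM s0 cats0.
Qed.

End Line.

(** * Solving the inequalities for the time *)

Local Open Scope ring_scope.

(** For positive [w] the ceiling is at least 1, so the left side is a natural number, [r] may be
    replaced by its integer part, and the truncated subtraction is harmless. *)
Lemma ceil_le_truncn (R : archiRealFieldType) (w m d : nat) (r : R) :
    (0 < w)%N -> (0 < m)%N -> 0 <= r ->
  (d%:R + (Num.ceil (w%:R / m%:R : R))%:~R - 1 <= r) =
  (w <= ((Num.truncn r).+1 - d) * m)%N.
Proof.
move=> w0 m0 r0.
have : 0 < Num.ceil (w%:R / m%:R : R) by rewrite ceil_gt0 divr_gt0 ?ltr0n.
have : forall k : nat, (Num.ceil (w%:R / m%:R : R) <= k%:Z) = (w <= k * m)%N.
  move=> k; rewrite ceil_le_int ler_pdivrMr ?ltr0n // -[k%:~R]/(k%:R).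
  by rewrite -natrM ler_nat.
case: (Num.ceil _) => // -[|b] // cP _; rewrite -cP lez_nat -[_%:~R]/(b.+1%:R).
have -> : d%:R + b.+1%:R - 1 = (d + b)%:R :> R
  by rewrite -natr1 natrD addrA addrK.
by rewrite -truncn_ge_nat //; lia.
Qed.

Lemma inf_ge (R : realType) (b : R) : inf [set r : R | b <= r]%classic = b.
Proof.
apply/eqP; rewrite eq_le; apply/andP; split.
  by apply: ge_inf => //=; exists b.
by apply: lb_le_inf => //; exists b => /=.
Qed.

(** * People, delays and arrivals on a dynamic path *)

Section Side.
Context {R : realType} {n : nat} (P : dynpath R n) (x : R).

Lemma mem_people v (p : person P) : (p \in people P v) = (tag p == v).
Proof.
apply/mapP/eqP => [[j _ ->] //|]; case: p => u j /= equv.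
by rewrite -equv; exists j => //; rewrite mem_enum.
Qed.

Lemma uniq_people v : uniq (people P v).
Proof.
rewrite map_inj_uniq ?enum_uniq // => j j' /eqP.
by rewrite eq_Tagged => /eqP.
Qed.

Lemma size_people v : size (people P v) = wt P v.
Proof. by rewrite size_map size_enum_ord. Qed.

Definition delay (u v : 'I_n.+1) : nat :=
  Num.truncn (`|pos P u - pos P v| * tau P).

Lemma delayE u v : `|pos P u - pos P v| * tau P = (delay u v)%:R.
Proof.
rewrite truncnK // natrEint dist_int mulr_ge0 //; exact/ltW/tau_gt0.
Qed.

Lemma arrivals0 (Q : nat -> _ -> seq (person P)) t v :
  (forall u, feeds P x u v = false) ->
  arrivals x Q t v = [::].
Proof. by move=> nofeed; rewrite /arrivals big_pred0. Qed.

Lemma arrivals1 (Q : nat -> _ -> seq (person P)) t u v :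
  (forall u', feeds P x u' v = (u' == u)) ->
  (0 < delay u v)%N ->
  arrivals x Q t v =
  if (delay u v <= t)%N then wave x Q (t - delay u v) u else [::].
Proof.
move=> feedu d0; rewrite /arrivals (big_pred1 u) //.
case: leqP => led.
  have lt_s : (t - delay u v < t)%N by lia.
  rewrite (big_pred1 (Ordinal lt_s)) // => s /=.
  by rewrite delayE -natrD eqr_nat -val_eqE /=; lia.
rewrite big_pred0 // => s.
by rewrite delayE -natrD eqr_nat; lia.
Qed.

(* Nobody crosses the sink. *)
Lemma queue_side (S : pred 'I_n.+1) :
    (forall u v, feeds P x u v -> S v -> S u) ->
  forall t v p, p \in queue P x t v -> S v -> S (tag p).
Proof.
move=> feedS; elim/ltn_ind => -[|t] IHt v p.
  by rewrite queue0 mem_people => /eqP->.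
rewrite queueS mem_cat => /orP[/mem_drop|]; first exact: IHt.
rewrite /arrivals => + Sv.
elim/big_rec: _ => // u s feedu IHs; rewrite mem_cat => /orP[|//].
elim/big_rec: _ => // i s' _ IHs'; rewrite mem_cat => /orP[/mem_take|//].
by move=> /IHt; apply=> //; exact: feedS Sv.
Qed.

(** * Evacuation time of one side of the sink *)

Section Stations.
(* [f] lists the vertices S on one side of the sink, the farthest first.      *)
Context (S : pred 'I_n.+1) (M : nat) (f : nat -> 'I_n.+1).
Context (wgt mcap : 'I_n.+1 -> nat).
Let y m := `|x - pos P (f m)|.
Hypothesis sideP : forall v, reflect (exists2 m, (m <= M)%N & v = f m) (S v).
Hypothesis f_inj : forall l m, (l <= M)%N -> (m <= M)%N -> f l = f m -> l = m.
Hypothesis feeds0 : forall u, feeds P x u (f 0) = false.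
Hypothesis feedsS : forall m u, (m < M)%N -> feeds P x u (f m.+1) = (u == f m).
Hypothesis dist_y : forall l m, (l <= m <= M)%N ->
  `|pos P (f l) - pos P (f m)| = y l - y m.
Hypothesis y_gt0 : 0 < y M.
Hypothesis y_lt : forall m, (m < M)%N -> y m.+1 < y m.
Hypothesis last_fM : last_stop P x (f M).
(** The sink may have a last stop on each side; people of [S] queue only at their own. *)
Hypothesis lastP : forall v t (p : person P), last_stop P x v ->
  p \in queue P x t v -> S (tag p) -> v = f M.
Hypothesis wgt0 : wgt (f 0) = wt P (f 0).
Hypothesis wgtS : forall m, (m < M)%N ->
  wgt (f m.+1) = (wt P (f m.+1) + wgt (f m))%N.
Hypothesis mcap_le : forall u j, (u <= j <= M)%N ->
  (mcap (f u) <= out_cap P x (f j))%N.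
Hypothesis mcap_mem : forall u, (u <= M)%N ->
  exists2 j, (u <= j <= M)%N & mcap (f u) = out_cap P x (f j).
Hypothesis out_cap_gt0 : forall m, (m <= M)%N -> (0 < out_cap P x (f m))%N.

Let a m := delay (f 0) (f m).
Let c m := out_cap P x (f m).
Let ppl m := people P (f m).
Let q t m := queue P x t (f m).

Lemma y_ge m : (m <= M)%N -> y M <= y m.
Proof.
by move=> lemM; rewrite -subr_ge0 -dist_y ?lemM ?normr_ge0 /=.
Qed.

Lemma aE m : (m <= M)%N -> (a m)%:R = (y 0 - y m) * tau P.
Proof. by move=> lemM; rewrite -delayE dist_y. Qed.

Lemma delay_sub l m : (l <= m <= M)%N -> delay (f l) (f m) = (a m - a l)%N.
Proof.
move=> lelm; have [leM lM] : (m <= M)%N /\ (l <= M)%N by lia.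
suff : a m = (delay (f l) (f m) + a l)%N by lia.
apply/eqP; rewrite -(eqr_nat R) natrD !aE // -delayE dist_y //.
by rewrite -mulrDl [X in _ == X * _]addrC addrA subrK.
Qed.

Lemma station_lt m : (m < M)%N -> (a m < a m.+1)%N.
Proof.
move=> ltM; have lemM := ltnW ltM; rewrite -(ltr_nat R) !aE //.
by rewrite ltr_pM2r ?tau_gt0 // ltrD2l ltrN2 y_lt.
Qed.

Lemma q0E m : (m <= M)%N -> q 0 m = ppl m.
Proof. by []. Qed.

Lemma qS0E t : q t.+1 0 = drop (c 0) (q t 0).
Proof. by rewrite /q queueS arrivals0 ?cats0. Qed.

Lemma qSSE t m : (m < M)%N ->
  q t.+1 m.+1 = drop (c m.+1) (q t m.+1) ++
    (if (a m.+1 - a m <= t.+1)%N then take (c m) (q (t.+1 - (a m.+1 - a m)) m)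
     else [::]).
Proof.
move=> ltM; rewrite /q queueS (@arrivals1 _ _ (f m)) => [|u|].
- by rewrite delay_sub // leqnSn.
- exact: feedsS.
by have := station_lt ltM; rewrite delay_sub ?leqnSn //; lia.
Qed.

Lemma mem_upstream m (p : person P) :
  reflect (exists2 l, (l <= m)%N & tag p = f l) (p \in upstream ppl m).
Proof.
elim: m => [|m IHm] /=.
  rewrite mem_people; apply: (iffP eqP) => [->|[l]]; first by exists 0.
  by rewrite leqn0 => /eqP->.
rewrite mem_cat mem_people; apply: (iffP orP) => [[/eqP->|/IHm[l lelm ->]]|].
- by exists m.+1.
- by exists l => //; exact: leqW.
move=> [l]; rewrite leq_eqVlt => /predU1P[-> ->|lelm lE]; first by left.
by right; apply/IHm; exists l.
Qed.

Lemma uniq_upstream m : (m <= M)%N -> uniq (upstream ppl m).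
Proof.
elim: m => [|m IHm] lemM /=; first exact: uniq_people.
rewrite cat_uniq uniq_people IHm 1?ltnW // andbT;
  apply/hasPn => p /mem_upstream[l lel lE].
rewrite mem_people lE; apply/eqP => /f_inj eql; have := eql ltac:(lia) lemM;
  lia.
Qed.

Lemma size_upstream m : (m <= M)%N -> size (upstream ppl m) = wgt (f m).
Proof.
elim: m => [|m IHm] lemM /=; first by rewrite wgt0 size_people.
by rewrite size_cat wgtS // IHm 1?ltnW // size_people.
Qed.

Lemma all_departedE t : {subset upstream ppl M <= departed c q M t} <->
  (forall u j, (u <= j <= M)%N ->
     (size (upstream ppl u) <= (t - (a M - a u)) * c j)%N).
Proof.
exact: (all_departed station_lt q0E qS0E qSSE t (uniq_upstream (leqnn M))).
Qed.

Lemma mem_departed m t p :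
  reflect (exists2 s, (s < t)%N & p \in wave x (queue P x) s (f m))
          (p \in departed c q m t).
Proof.
elim: t => [|t IHt] /=; first by apply: (iffP idP) => // -[].
rewrite mem_cat; apply: (iffP orP) => [[/IHt[s lts ps]|]|].
- by exists s => //; exact: leqW.
- by exists t.
move=> [s]; rewrite ltnS leq_eqVlt => /predU1P[->|lts ps]; first by right.
by left; apply/IHt; exists s.
Qed.

Lemma not_sink v : S v -> pos P v <> x.
Proof.
move=> /sideP[m lemM ->] px; have := lt_le_trans y_gt0 (y_ge lemM).
by rewrite /y px subrr normr0 ltxx.
Qed.

Lemma station_le m : (m <= M)%N -> (a m <= a M)%N.
Proof. by move=> lemM; apply: (@a_le M a station_lt); rewrite lemM leqnn. Qed.

(** The wave must leave the last stop at an integer time at most [T - y M * tau P]; the successor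
    appears because [departed] uses a strict bound. *)
Lemma side_reached T (p : person P) : S (tag p) -> y M * tau P <= T ->
  reached_by x T p <-> p \in departed c q M (Num.truncn (T - y M * tau P)).+1.
Proof.
move=> Sp leT; split.
  move=> [[px _]|[v [s [lastv ps les]]]]; first by case: (not_sink Sp px).
  have vE : v = f M by apply: lastP Sp => //; exact: mem_take ps.
  apply/mem_departed; exists s; last by rewrite -vE.
  by rewrite ltnS truncn_ge_nat ?subr_ge0 // lerBrDr -/(y M) /y -vE.
move=> /mem_departed[s les ps]; right; exists (f M); exists s; split => //.
by rewrite -lerBrDr -truncn_ge_nat // subr_ge0.
Qed.

(** Treated apart because [Num.truncn] sends a negative [T - y M * tau P] to 0. *)
Lemma not_reached T (p : person P) : T < y M * tau P ->
  ~ (S (tag p) /\ reached_by x T p).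
Proof.
move=> ltT [Sp [[px _]|[v [s [lastv ps les]]]]]; first exact: not_sink Sp px.
have vE : v = f M by apply: lastP Sp => //; exact: mem_take ps.
have : y M * tau P <= T by apply: le_trans les; rewrite vE lerDr.
by rewrite leNgt ltT.
Qed.

(** The travel time from [f u] is the integer [a M - a u] plus the possibly fractional last leg
    [y M * tau P]. *)
Lemma side_term T u : (u <= M)%N -> (0 < wgt (f u))%N -> y M * tau P <= T ->
  (`|x - pos P (f u)| * tau P
   + (Num.ceil ((wgt (f u))%:R / (mcap (f u))%:R : R))%:~R - 1 <= T) =
  (wgt (f u) <=
     ((Num.truncn (T - y M * tau P)).+1 - (a M - a u)) * mcap (f u))%N.
Proof.
move=> leuM w0 leT; rewrite -ceil_le_truncn ?subr_ge0 //.
  rewrite natrB ?station_le // !aE // lerBrDr -/(y u).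
  congr (_ <= T); ring.
have [j leuj ->] := mcap_mem leuM; apply: out_cap_gt0; lia.
Qed.

Lemma evacuation_time :
  inf [set T : R | 0 <= T /\
         forall p : person P, S (tag p) -> reached_by x T p]%classic =
  \big[Num.max/0]_(i < n.+1 | S i && (0 < wgt i)%N)
     (`|x - pos P i| * tau P
      + (Num.ceil ((wgt i)%:R / (mcap i)%:R : R))%:~R - 1).
Proof.
(* It suffices that the feasible times are exactly the upper bounds of 0 and of all terms. *)
rewrite -[RHS]inf_ge; congr inf; apply/seteqP; split => T /=.
  move=> [T0 reached]; apply/bigmax_leP; split => // i /andP[].
  move=> /sideP[u leuM ->{i}] w0;
    have W0 : (0 < size (upstream ppl u))%N by rewrite size_upstream.
  case: (leP (y M * tau P) T) => [leT|ltT]; last first.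
    have [p /mem_upstream[l lel pl]] : exists p, p \in upstream ppl u.
      by case: (upstream _ _) W0 => // p s _; exists p; rewrite mem_head.
    have Sp : S (tag p) by apply/sideP; exists l => //; lia.
    by case: (@not_reached T p ltT); split=> //; exact: reached.
  have /all_departedE leW :
      {subset upstream ppl M <=
         departed c q M (Num.truncn (T - y M * tau P)).+1}.
    move=> p /mem_upstream[l lel pl]; have Sp : S (tag p) by apply/sideP;
      exists l.
    by apply/side_reached => //; exact: reached.
  rewrite side_term //.
  by have [j leuj ->] := mcap_mem leuM; rewrite -size_upstream // leW.
move=> /bigmax_leP[T0 leT]; split=> // p Sp.
have [m lemM pm] : exists2 m, (m <= M)%N & tag p = f m by apply/sideP.
have wM : (0 < wgt (f M))%N.
  rewrite -size_upstream //; have : p \in upstream ppl M.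
    by apply/mem_upstream; exists m.
  by case: (upstream _ _).
(* The term of the last stop is at least its travel time, its ceiling being at least 1. *)
have leyT : y M * tau P <= T.
  have /leT : S (f M) && (0 < wgt (f M))%N by rewrite wM andbT; apply/sideP;
    exists M.
  apply: le_trans; rewrite -addrA lerDl subr_ge0 ler1z.
  have [j lej mE] := mcap_mem (leqnn M).
  rewrite -gtz0_ge1 ceil_gt0 divr_gt0 ?ltr0n // mE out_cap_gt0 //; lia.
apply/side_reached => //.
suff : {subset upstream ppl M <=
          departed c q M (Num.truncn (T - y M * tau P)).+1}.
  by apply; apply/mem_upstream; exists m.
apply/all_departedE => u j leuj; have leuM : (u <= M)%N by lia.
rewrite size_upstream //; case: (posnP (wgt (f u))) => [->//|w0].
have /leT : S (f u) && (0 < wgt (f u))%N.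
  by rewrite w0 andbT; apply/sideP; exists u.
rewrite side_term // => /leq_trans; apply.
by rewrite leq_mul2l mcap_le // orbT.
Qed.

End Stations.
End Side.

(** * The two sides of the sink as lines of stations *)

Section Sides.
Context {R : realType} {n : nat} (P : dynpath R n).

Lemma pos_lt_ord i j : (pos P i < pos P j) = (i < j)%N.
Proof.
case: (ltngtP i j) => [/(pos_lt P)->//|/(pos_lt P) ltji|/val_inj->].
  by rewrite ltNge ltW.
by rewrite ltxx.
Qed.

Lemma pos_le_ord i j : (pos P i <= pos P j) = (i <= j)%N.
Proof. by rewrite leNgt pos_lt_ord -leqNgt. Qed.

Lemma min_cap_le (D : pred 'I_n.+1) j : D j -> (min_cap P D <= cap P j)%N.
Proof. by move=> Dj; exact: (@bigmin_le_cond _ nat _ _ _ D (cap P)). Qed.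

Lemma min_cap_mem (D : pred 'I_n.+1) j0 : D j0 ->
  exists2 j, D j & min_cap P D = cap P j.
Proof.
move=> Dj0.
have : min_cap P D = (\max_(l < n.+1) cap P l)%N \/
  exists2 j, D j & min_cap P D = cap P j.
  rewrite /min_cap; elim/big_rec: _ => [|j b Dj]; first by left.
  case: leqP => // _ _.
  by right; exists j.
(* If the minimum equals its default, the maximal capacity, it is at least [cap P j0], hence equal
   to it. *)
case=> // eq_max; exists j0 => //.
by apply/eqP; rewrite eqn_leq min_cap_le // eq_max leq_bigmax.
Qed.

Variables (x : R) (k : nat).
Hypothesis ltkn : (k < n)%N.
Hypothesis x_edge : pos P (inord k) < x <= pos P (inord k.+1).

Lemma left_ofE v : (pos P v < x) = (v <= k)%N.
Proof.
case/andP: x_edge => ltx lex; case: leqP => lev.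
  by apply: le_lt_trans ltx; rewrite pos_le_ord inordK //; lia.
apply/negbTE; rewrite -leNgt; apply: le_trans lex _.
by rewrite pos_le_ord inordK //; lia.
Qed.

(** First index strictly to the right of the sink; it is [n.+1] when the sink is the last vertex. *)
Let K := if x == pos P (inord k.+1) then k.+2 else k.+1.

Lemma right_ofE v : (x < pos P v) = (K <= v)%N.
Proof.
rewrite /K; case: eqVneq => [->|neqx]; first by rewrite pos_lt_ord inordK.
have ltx : x < pos P (inord k.+1) by rewrite lt_neqAle neqx; case/andP: x_edge.
case: (leqP k.+1 v) => lev.
  by apply: lt_le_trans ltx _; rewrite pos_le_ord inordK.
by apply/negbTE; rewrite -leNgt; apply: ltW; rewrite left_ofE.
Qed.

Lemma queue_left t v (p : person P) :
  p \in queue P x t v -> pos P v < x -> pos P (tag p) < x.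
Proof.
apply: (@queue_side _ _ P x (fun v => pos P v < x)) =>
  u w /orP[] /andP[/eqP uw].
  by move=> _; apply: lt_trans; rewrite pos_lt_ord; lia.
by move=> lexw; rewrite ltNge lexw.
Qed.

Lemma queue_right t v (p : person P) :
  p \in queue P x t v -> x < pos P v -> x < pos P (tag p).
Proof.
apply: (@queue_side _ _ P x (fun v => x < pos P v)) =>
  u w /orP[] /andP[/eqP uw].
  by move=> lexw; rewrite ltNge lexw.
by move=> _ /lt_trans; apply; rewrite pos_lt_ord; lia.
Qed.

Lemma Theta_LE :
  Theta_L P x =
  \big[Num.max/0]_(i < n.+1 | (pos P i < x) && (0 < left_weight P i)%N)
    left_term P x k i.
Proof.
pose S v := pos P v < x; pose f m : 'I_n.+1 := inord m.
have fE m : (m <= k)%N -> f m = m :> nat by move=> ?; rewrite inordK //; lia.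
have Sf m : (m <= k)%N -> pos P (f m) < x by move=> ?; rewrite left_ofE fE.
have distE m : (m <= k)%N -> `|x - pos P (f m)| = x - pos P (f m).
  by move=> /Sf ltx; rewrite ger0_norm // subr_ge0 ltW.
have out_capE m : (m <= k)%N -> out_cap P x (f m) = cap P (inord m.+1).
  by move=> lem; rewrite /out_cap Sf // fE.
transitivity (\big[Num.max/0]_(i < n.+1 | S i && (0 < left_weight P i)%N)
   (`|x - pos P i| * tau P + (Num.ceil ((left_weight P i)%:R /
     (min_cap P (fun j => (i.+1 <= j <= k.+1)%N))%:R : R))%:~R - 1));
  last first.
  by apply: eq_bigr => i /andP[Si _]; rewrite ger0_norm // subr_ge0 ltW.
apply: (@evacuation_time _ _ P x S k f (left_weight P)
  (fun i => min_cap P (fun j => (i.+1 <= j <= k.+1)%N))).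
- move=> v; rewrite /S left_ofE; apply: (iffP idP) => [lev|[m lem ->]].
    by exists v => //; rewrite /f inord_val.
  by rewrite fE.
- by move=> l m lel lem /(congr1 val) /=; rewrite !fE.
- move=> u; rewrite /feeds [_ <= x]ltW ?Sf // [x <= _]leNgt Sf //= andbF orbF.
  by rewrite fE.
- move=> m u ltm; rewrite /feeds [_ <= x]ltW ?Sf //
    [x <= _]leNgt Sf //= andbF orbF.
  by rewrite fE // andbT eqSS -val_eqE /= fE // ltnW.
- move=> l m /andP[lelm lem]; rewrite !distE //; last exact: leq_trans lem.
  rewrite distrC ger0_norm; first ring.
  by rewrite subr_ge0 pos_le_ord !fE //; exact: leq_trans lem.
- by rewrite distE // subr_gt0 Sf.
- by move=> m ltm; have lem := ltnW ltm;
    rewrite !distE // ltrD2l ltrN2 pos_lt_ord !fE.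
- by apply/orP; left; rewrite fE // Sf //; case/andP: x_edge.
- move=> v t p /orP[] /andP[] => [ltv lev _ _|_ ltv pv].
    apply: val_inj; rewrite /= fE //; move: ltv lev;
      rewrite left_ofE leNgt left_ofE => lek.
    rewrite inordK; lia.
  by rewrite /S ltNge ltW // (queue_right pv).
- by rewrite /left_weight (big_pred1 (f 0)) // => j;
    rewrite /= -val_eqE /= fE // leqn0.
- move=> m ltm; have lem := ltnW ltm;
    rewrite /left_weight (bigD1 (f m.+1)) //=; congr addn.
  by apply: eq_bigl => j; rewrite -val_eqE /= !fE //; lia.
- move=> u j leuj; rewrite out_capE; last lia.
  by apply: min_cap_le; rewrite fE ?inordK //; lia.
- move=> u leu; have [|j] := @min_cap_mem (fun j =>
    (f u).+1 <= j <= k.+1)%N (inord k.+1).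
    by rewrite inordK // fE //; lia.
  rewrite fE // => lej ->.
  (* Edge [j] leaves station [j.-1] on the left side. *)
  exists j.-1; first lia.
  by rewrite out_capE; [congr cap; apply: val_inj; rewrite /= inordK|]; lia.
by move=> m lem; rewrite out_capE //; apply: cap_gt0; rewrite inordK //; lia.
Qed.

Lemma Theta_RE :
  Theta_R P x =
  \big[Num.max/0]_(i < n.+1 | (x < pos P i) && (0 < right_weight P i)%N)
    right_term P x i.
Proof.
have /andP[K0 ltkK] : (0 < K)%N && (k < K <= k.+2)%N by rewrite /K; case: ifP;
  lia.
(* With no vertex to the right of the sink, both sides are 0. *)
case: (leqP K n) => [leKn|ltnK]; last first.
  have noR v : (x < pos P v) = false.
    by rewrite right_ofE; apply/negbTE; rewrite -ltnNge; have := ltn_ord v; lia.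
  rewrite big_pred0 => [|v]; last by rewrite noR.
  rewrite -[RHS]inf_ge; congr inf; apply/seteqP; split => T /=; first by case.
  by move=> T0; split=> // p; rewrite noR.
pose S v := x < pos P v; pose M := (n - K)%N;
  pose f m : 'I_n.+1 := inord (n - m).
have fE m : f m = (n - m)%N :> nat by rewrite inordK //; lia.
have Sf m : (m <= M)%N -> x < pos P (f m) by move=> ?; rewrite right_ofE fE;
  lia.
have distE m : (m <= M)%N -> `|x - pos P (f m)| = pos P (f m) - x.
  by move=> /Sf ltx; rewrite distrC ger0_norm // subr_ge0 ltW.
have out_capE m : (m <= M)%N -> out_cap P x (f m) = cap P (f m).
  by move=> lem; rewrite /out_cap Sf // ltNge ltW ?Sf.
transitivity (\big[Num.max/0]_(i < n.+1 | S i && (0 < right_weight P i)%N)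
   (`|x - pos P i| * tau P + (Num.ceil ((right_weight P i)%:R /
     (min_cap P (fun j => (j <= i)%N && (x < pos P j)))%:R : R))%:~R - 1));
  last first.
  by apply: eq_bigr => i /andP[Si _]; rewrite distrC ger0_norm // subr_ge0 ltW.
apply: (@evacuation_time _ _ P x S M f (right_weight P)
  (fun i => min_cap P (fun j => (j <= i)%N && (x < pos P j)))).
- move=> v; rewrite /S right_ofE; apply: (iffP idP) => [lev|[m lem ->]].
    exists (n - v)%N; first by rewrite /M; lia.
    by apply: val_inj; rewrite /= fE subKn // -ltnS.
  by rewrite fE; move: lem; rewrite /M; lia.
- by move=> l m lel lem /(congr1 val) /=; rewrite !fE; move: lel lem;
    rewrite /M; lia.
- move=> u; rewrite /feeds [pos P _ <= x]leNgt Sf //= andbF /=.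
  by rewrite fE subn0 gtn_eqF.
- move=> m u ltm; rewrite /feeds [pos P _ <= x]leNgt [x <= _]ltW Sf //= andbF
    andbT /=.
  by rewrite -val_eqE /= !fE; move: ltm; rewrite /M; lia.
- move=> l m /andP[lelm lem]; rewrite !distE //; last exact: leq_trans lem.
  rewrite ger0_norm; first ring.
  by rewrite subr_ge0 pos_le_ord !fE; lia.
- by rewrite distE // subr_gt0 Sf.
- move=> m ltm; have lem := ltnW ltm; rewrite !distE // ltrD2r pos_lt_ord !fE.
  by move: ltm; rewrite /M; lia.
- apply/orP; right; rewrite Sf // andbT leNgt right_ofE fE inordK; lia.
- move=> v t p /orP[] /andP[] => [ltv _ pv|+ ltv _ _].
    by rewrite /S ltNge ltW // (queue_left pv).
  move: ltv; rewrite right_ofE leNgt right_ofE inordK;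
    last by have := ltn_ord v; lia.
  by move=> leKv ltvK; apply: val_inj; rewrite /= fE /M; lia.
- rewrite /right_weight (big_pred1 (f 0)) // => j; rewrite /= -val_eqE /= fE.
  by have := ltn_ord j; lia.
- move=> m ltm; rewrite /right_weight (bigD1 (f m.+1)) //=; congr addn.
  by apply: eq_bigl => j; rewrite -val_eqE /= !fE; move: ltm; rewrite /M; lia.
- move=> u j /andP[leuj lej]; rewrite out_capE //.
  by apply: min_cap_le; rewrite Sf // !fE; lia.
- move=> u leu.
  have [|j] := @min_cap_mem (fun j => (j <= f u)%N && (x < pos P j)) (f u).
    by rewrite leqnn Sf.
  rewrite right_ofE fE => /andP[leju lej] ->.
  have le_nj : (n - j <= M)%N by rewrite /M; lia.
  exists (n - j)%N; first by rewrite le_nj andbT; move: leu; rewrite /M; lia.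
  by rewrite out_capE //; congr cap; apply: val_inj;
    rewrite /= fE subKn // -ltnS.
by move=> m lem; rewrite out_capE //; apply: cap_gt0; rewrite fE; move: lem;
  rewrite /M; lia.
Qed.

End Sides.

(* MathComp world.  The last two equations are the formulas over all indices, *)
(* for paths with somebody at x_0 (resp. x_n); the first two hold for all     *)
(* nonnegative weights, terms with nobody to evacuate being left out.         *)
Theorem theorem1 (R : realType) (n : nat) (P : dynpath R n) (x : R) (k : nat)
    (hk : (k < n)%N)
    (hx : pos P (inord k) < x <= pos P (inord k.+1)) :
  [/\ Theta_L P x =
        \big[Num.max/0]_(i < n.+1 | (pos P i < x) && (0 < left_weight P i)%N)
          left_term P x k i,
      Theta_R P x =
        \big[Num.max/0]_(i < n.+1 | (x < pos P i) && (0 < right_weight P i)%N)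
          right_term P x i,
      (0 < wt P ord0)%N ->
        Theta_L P x =
          \big[Num.max/0]_(i < n.+1 | pos P i < x) left_term P x k i
    & (0 < wt P ord_max)%N ->
        Theta_R P x =
          \big[Num.max/0]_(i < n.+1 | x < pos P i) right_term P x i].
Proof.
split; [exact: Theta_LE|exact: (Theta_RE hk)|move=> w0|move=> wn].
  (* Every [left_weight] includes the positive weight of the first vertex, so the filter on positive
     weights is vacuous. *)
  rewrite (Theta_LE hk hx); apply: eq_bigl => i.
  by rewrite /left_weight (bigD1 ord0) //= addn_gt0 w0 andbT.
rewrite (Theta_RE hk hx); apply: eq_bigl => i.
by rewrite /right_weight (bigD1 ord_max) ?leq_ord //= addn_gt0 wn andbT.
Qed.
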